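(* Let $\mathcal M$ be a countable MDP with initial state $s_0$, let $\{A_i\}_{i\in\mathbb N}$ be a sequence of sets of transitions of $\mathcal M$ that is monotone decreasing with respect to set inclusion, and consider the objective $\varphi=\bigcap_{i\in\mathbb N}\mathsf G\mathsf F A_i$. Let $\varepsilon>0$. (1) If $\mathcal M$ is universally transient, then there exists a deterministic 1-bit strategy that is $\varepsilon$-optimal for $\varphi$ from $s_0$. (2) In general (even if $\mathcal M$ is not universally transient), there exists a deterministic strategy using a step counter plus one bit of memory (a Det(SC+1-bit) strategy) that is $\varepsilon$-optimal for $\varphi$ from $s_0$.
   Context: An MDP $\mathcal M$ consists of a countable set $S$ of states partitioned into controlled states $S_C$ and random states $S_R$; a transition relation $\longrightarrow\subseteq S\times S$ such that every state has at least one successor (the set $\mathrm{Succ}(s)$ of successors of $s$ may be infinite); and a function $P$ assigning to each random state $s$ a probability distribution on $\mathrm{Succ}(s)$. A run is an infinite sequence $s_0e_0s_1e_1\cdots$ with $e_i=(s_i,s_{i+1})\in\longrightarrow$; a history is a finite prefix of a run ending in a controlled state. A (general) strategy $\sigma$ maps each history ending in $s$ to a probability distribution on $\mathrm{Succ}(s)$. A strategy and a start state $s$ induce a probability measure $\mathcal P_{\mathcal M,s,\sigma}$ on the Borel $\sigma$-algebra of runs from $s$. Memory: a memory-based strategy has a set $\mathsf M$ of memory modes and an initial mode; at a controlled state it picks the successor depending only on the current state and current mode, and after every step from $s$ to $s'$ (from controlled or random $s$) it updates its mode depending only on the current mode, $s$ and $s'$. It is deterministic if all these choices are deterministic. A deterministic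 1-bit strategy is a deterministic memory-based strategy with at most two memory modes. A Det(SC+1-bit) strategy is a deterministic memory-based strategy with $\mathsf M=\mathbb N\times\{0,1\}$ whose first component is always the number of steps taken so far. For an event $\varphi$, $\mathrm{val}(s)=\sup_\sigma\mathcal P_{\mathcal M,s,\sigma}(\varphi)$ over all strategies; $\sigma$ is $\varepsilon$-optimal for $\varphi$ from $s$ if $\mathcal P_{\mathcal M,s,\sigma}(\varphi)\ge\mathrm{val}(s)-\varepsilon$. $\mathsf G\mathsf F A$ is the set of runs that take transitions in $A$ infinitely often. $\mathcal M$ is universally transient if for every start state and every strategy, almost every run visits no state infinitely often. *)

(* Defs.v *)
From HB Require Import structures.
From mathcomp Require Import all_boot all_order all_algebra.
From mathcomp Require Import all_classical all_reals all_analysis.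

Set Implicit Arguments.
Unset Strict Implicit.
Unset Printing Implicit Defensive.

Import Order.TTheory GRing.Theory Num.Theory.
Local Open Scope classical_set_scope.
Local Open Scope ring_scope.

Definition dist_on (R : realType) (S : choiceType) (B : set S) (f : S -> R) :=
  [/\ forall t, 0 <= f t,
      forall t, ~ B t -> f t = 0 &
      (\esum_(t in B) (f t)%:E = 1)%E].

(* A state is random when it is not controlled; [trans M s] is meaningless
   (and never used) at a controlled state [s]. *)
Record mdp (R : realType) (S : countType) := MDP {
  ctrl : pred S ;
  step : rel S ;
  trans : S -> S -> R ;
  step_total : forall s, exists t, step s t ;
  trans_dist : forall s, ~~ ctrl s -> dist_on [set t | step s t] (trans s)
}.

(* A history s_0 s_1 ... s_n is given by its first state [s] and the sequence
   [w] of the n states that follow; its last state is [last s w]. *)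
Record strategy (R : realType) (S : countType) (M : mdp R S) := Strategy {
  choice :> S -> seq S -> S -> R ;
  choice_dist : forall s w, path (step M) s w -> ctrl M (last s w) ->
    dist_on [set t | step M (last s w) t] (choice s w)
}.

(* The sequences of states, with the sigma-algebra generated by the cylinders,
   i.e. the Borel sigma-algebra of the product topology, S being discrete.
   The start state [s] only provides the inhabitant that the library requires
   of a measurable type. Sequences that are not runs from [s] are included, but
   they form a null set for every measure satisfying [run_measure] below. *)
Definition cylinder (S : Type) (u : seq S) : set (nat -> S) :=
  [set rho | mkseq rho (size u) = u].

Definition trajectory (S : choiceType) (s : S) : Type := nat -> S.

HB.instance Definition _ (S : choiceType) (s : S) :=
  Choice.on (trajectory s).
HB.instance Definition _ (S : choiceType) (s : S) :=
  isPointed.Build (trajectory s) (fun=> s).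

Definition run_space (S : choiceType) (s : S) :=
  g_sigma_algebraType (range (@cylinder S) : set (set (trajectory s))).

Section RunMeasure.
Variables (R : realType) (S : countType) (M : mdp R S).

Definition step_prob (sigma : strategy M) (s : S) (w : seq S) (t : S) : R :=
  if ctrl M (last s w) then sigma s w t else trans M (last s w) t.

(* These cylinder probabilities determine the measure induced by [sigma] from
   [s] uniquely. *)
Definition run_measure (s : S) (sigma : strategy M)
    (P : probability (run_space s) R) :=
  forall w, P (cylinder (s :: w)) =
    (\prod_(i < size w) step_prob sigma s (take i w) (nth s w i))%:E.

Definition value (phi : set (nat -> S)) (s : S) : \bar R :=
  ereal_sup [set p | exists sigma : strategy M,
    exists2 P : probability (run_space s) R, run_measure sigma P & p = P phi].

Definition eps_optimal (phi : set (nat -> S)) (s : S) (eps : R)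
    (sigma : strategy M) :=
  exists2 P : probability (run_space s) R,
    run_measure sigma P & (value phi s - eps%:E <= P phi)%E.

End RunMeasure.

Definition infinitely_often (E : nat -> Prop) :=
  forall n, exists2 m, (n <= m)%N & E m.

Definition GF (R : realType) (S : countType) (M : mdp R S) (A : set (S * S)) :
    set (nat -> S) :=
  [set rho | (forall i, step M (rho i) (rho i.+1)) /\
             infinitely_often (fun i => A (rho i, rho i.+1))].

Definition universally_transient (R : realType) (S : countType)
    (M : mdp R S) :=
  forall (s : S) (sigma : strategy M) (P : probability (run_space s) R),
    run_measure sigma P ->
    {ae P, forall rho, forall q, ~ infinitely_often (fun i => rho i = q)}.

Record det_mem_strategy (R : realType) (S : countType) (M : mdp R S)
    (Mem : Type) := DetMemStrategy {
  init_mode : Mem ;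
  next_state : Mem -> S -> S ;
  next_mode : Mem -> S -> S -> Mem ;
  next_state_step : forall m s, ctrl M s -> step M s (next_state m s)
}.

Section MemoryBased.
Variables (R : realType) (S : countType) (M : mdp R S) (Mem : Type).
Variable tau : det_mem_strategy M Mem.

Fixpoint mode_after (m : Mem) (s : S) (w : seq S) : Mem :=
  if w is t :: w' then mode_after (next_mode tau m s t) t w' else m.

Definition mem_choice (s : S) (w : seq S) (t : S) : R :=
  (t == next_state tau (mode_after (init_mode tau) s w) (last s w))%:R.

Lemma mem_choice_dist s w : path (step M) s w -> ctrl M (last s w) ->
  dist_on [set t | step M (last s w) t] (mem_choice s w).
Proof.
move=> _ /(next_state_step tau (mode_after (init_mode tau) s w)).
rewrite /mem_choice; set u := next_state _ _ _ => su; split=> [t|t nst|].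
- exact: ler0n.
- by case: eqP nst => // ->.
- rewrite (esumID [set u]) => [|t _]; last by rewrite lee_fin ler0n.
  rewrite setI1 mem_set// esum_set1 ?lee_fin ?ler0n// eqxx.
  by rewrite esum1 ?adde0// => t [_ /= /eqP/negPf ->].
Qed.

Definition mem_strategy : strategy M := Strategy mem_choice_dist.

End MemoryBased.

Definition counts_steps (R : realType) (S : countType) (M : mdp R S)
    (B : Type) (tau : det_mem_strategy M (nat * B)) :=
  (init_mode tau).1 = 0%N /\
  forall m s t, (next_mode tau m s t).1 = m.1.+1.

(* Main.v *)
Require Import Defs.
From HB Require Import structures.
From mathcomp Require Import all_boot all_order all_algebra.
From mathcomp Require Import all_classical all_reals all_analysis.
From mathcomp Require Import zify lra.

(* Let [sigma] be nearly optimal. Since almost every run is transient, one can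
   choose an increasing exhaustion F_0, F_1, ... of the state space by finite
   sets and times N_0, N_1, ... such that, up to a small probability of losing,
   a winning run of [sigma] stays in F_{j+1} until time N_j, never visits F_j
   after N_j, and takes before N_j a transition of A_j from F_{j+1} \ F_j. Such
   a run goes through phases k = 1, 2, ...: phase k ends with the first
   transition of A_k that starts in the ring F_{2k} \ F_{2k-1}, and takes place
   in F_{2k} \ F_{2k-4}. The state determines k up to an ambiguity between two
   consecutive values, so one bit, the parity of k, suffices to know the phase.
   "Always stay within the region of the current phase" is a safety objective
   with only finitely many safe successors at each configuration, so it has an
   optimal strategy that depends only on the state and the bit. A transient run
   that is safe forever must go through all the phases, hence wins, because the
   sets A_i decrease. For (2), pair the states with the step counter: all runs
   are then transient. *)

Set Implicit Arguments.
Unset Strict Implicit.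
Unset Printing Implicit Defensive.

Import Order.TTheory GRing.Theory Num.Theory.
Local Open Scope classical_set_scope.
Local Open Scope ring_scope.

(** * The measure induced by a strategy *)

(** Normalising a measure of total mass 1 changes none of its values and supplies the [probability]
    structure. *)
Lemma measure_probability d (T : measurableType d) (R : realType)
    (mu : {measure set T -> \bar R}) : mu setT = 1%E ->
  exists P : probability T R, forall U, P U = mu U.
Proof.
move=> mu1; exists (mnormalize mu point) => U.
rewrite -[LHS]/(mnormalize mu point U) /mnormalize; cbv zeta.
by rewrite mu1 onee_eq0/= invr1 mule1.
Qed.

(** An event decided by the first [n] states is the union of the cylinders of the words of length
    [n] that it meets, and there are only countably many words. *)
Lemma measurable_local (S : countType) (s : S) (n : nat)
    (E : set (run_space s)) :
  (forall rho rho' : nat -> S, (forall i, (i < n)%N -> rho i = rho' i) ->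
    E rho -> E rho') -> measurable E.
Proof.
move=> Eloc.
have -> : E = \bigcup_(u : seq S)
    [set rho : run_space s | cylinder u rho /\
      exists2 rho' : nat -> S, E rho' & mkseq rho' n = u].
  apply/seteqP; split => [rho Erho|rho [u _ [/= + [rho' Er' ru]]]].
    exists (mkseq rho n) => //; split; last by exists rho.
    by rewrite /cylinder/= size_mkseq.
  rewrite /cylinder /= -ru size_mkseq => rr'.
  apply: (Eloc rho' rho _ Er') => i ltin.
  by rewrite -(nth_mkseq s rho' ltin) -rr' nth_mkseq.
apply: countable_bigcupT_measurable => [|u]; first exact: countableP.
have [Du|Du] := pselect (exists2 rho' : nat -> S, E rho' & mkseq rho' n = u).
  apply: sub_sigma_algebra; exists u => //.
  by apply/seteqP; split => [rho|rho []].
rewrite (_ : [set _ | _] = set0)//.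
by apply/seteqP; split => [rho []|].
Qed.

Section KernelMeasure.
Variables (R : realType) (S : countType) (s : S) (q : seq S -> S -> R).

Definition word_prob (w : seq S) : R :=
  \prod_(i < size w) q (take i w) (nth s w i).

(** Stated for words of nonzero probability because a strategy is constrained only after paths. *)
Hypothesis q_dist : forall w, word_prob w != 0 -> dist_on setT (q w).

Let g (w : seq S) (k : nat) : R :=
  if @pickle_inv S k is Some t then q w t else 0.

Let cumul (w : seq S) (n : nat) : R := \sum_(k < n) g w k.

(* The words of length n label disjoint half-open intervals that partition
   [0, 1), the interval of [w] having length [word_prob w]; the intervals of the
   words [rcons w t] partition the one of [w], in the order of [pickle t]. *)
Let left_end (w : seq S) : R :=
  \sum_(i < size w)
    word_prob (take i w) * cumul (take i w) (pickle (nth s w i)).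

Let itv (w : seq S) : set (measurableTypeR R) :=
  `[left_end w, left_end w + word_prob w[%classic.

Lemma word_prob_rcons w t : word_prob (rcons w t) = word_prob w * q w t.
Proof.
rewrite /word_prob size_rcons big_ord_recr/= nth_rcons ltnn eqxx.
rewrite -cats1 take_size_cat//; congr (_ * _); apply: eq_bigr => i _.
by rewrite nth_cat takel_cat ?(ltnW (ltn_ord i))// ltn_ord.
Qed.

Lemma word_prob_ge0 w : 0 <= word_prob w.
Proof.
elim/last_ind: w => [|w t IH]; first by rewrite /word_prob big_ord0.
rewrite word_prob_rcons; have [->|w0] := eqVneq (word_prob w) 0.
  by rewrite mul0r.
by rewrite mulr_ge0//; have [] := q_dist w0.
Qed.

Let left_end_rcons w t :
  left_end (rcons w t) = left_end w + word_prob w * cumul w (pickle t).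
Proof.
rewrite /left_end size_rcons big_ord_recr/= nth_rcons ltnn eqxx.
rewrite -cats1 take_size_cat//; congr (_ + _); apply: eq_bigr => i _.
by rewrite nth_cat takel_cat ?(ltnW (ltn_ord i))// ltn_ord.
Qed.

Let g_ge0 w k : word_prob w != 0 -> 0 <= g w k.
Proof. by move=> /q_dist[q0 _ _]; rewrite /g; case: pickle_inv. Qed.

Let g_pickle w t : g w (pickle t) = q w t.
Proof. by rewrite /g pickleK_inv. Qed.

Let cumulS w n : cumul w n.+1 = cumul w n + g w n.
Proof. by rewrite /cumul big_ord_recr. Qed.

Let cumul_mono w m n : word_prob w != 0 -> (m <= n)%N -> cumul w m <= cumul w n.
Proof.
move=> w0; elim: n => [|n IH]; first by rewrite leqn0 => /eqP->.
rewrite leq_eqVlt => /predU1P[->//|]; rewrite ltnS => /IH /le_trans; apply.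
by rewrite cumulS lerDl g_ge0.
Qed.

Let cumul_sum w n : word_prob w != 0 ->
  cumul w n = \sum_(t <- pmap (@pickle_inv S) (iota 0 n)) q w t.
Proof.
move=> w0; elim: n => [|n IH]; first by rewrite /cumul big_ord0 big_nil.
rewrite cumulS IH -addn1 iotaD add0n pmap_cat big_cat/=; congr (_ + _).
by rewrite /g; case: pickle_inv => [t|] /=; rewrite ?big_seq1 ?big_nil.
Qed.

Let pmap_inv_uniq n : uniq (pmap (@pickle_inv S) (iota 0 n)).
Proof.
apply: (@pmap_uniq _ _ (@pickle_inv S) pickle); last exact: iota_uniq.
exact: pickle_invK.
Qed.

Let cumul_le1 w n : word_prob w != 0 -> cumul w n <= 1.
Proof.
move=> w0; have [q0 _ q1] := q_dist w0.
rewrite -lee_fin -q1 cumul_sum// -sumEFin.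
apply: esum_ge; exists [set` pmap (@pickle_inv S) (iota 0 n)].
  by split => //; exact: finite_seq.
by rewrite fsbig_seq//; exact: pmap_inv_uniq.
Qed.

(** The mass 1 is a supremum of finite sums, and a finite set of states has all its codes below some
    [n]. *)
Let cumul_gt w y : word_prob w != 0 -> y < 1 -> exists n, y < cumul w n.
Proof.
move=> w0 y1; have [q0 _ q1] := q_dist w0.
move: y1; rewrite -lte_fin -q1 => /ereal_sup_gt[_ [X [fX _] <-]].
rewrite fsbig_finite//= sumEFin lte_fin => yX.
set r := finmap.enum_fset _ in yX.
exists (\max_(t <- r) (pickle t).+1)%N; apply: lt_le_trans yX _.
rewrite cumul_sum//; set r' := pmap _ _.
have rr' : {subset r <= r'}.
  move=> t tr; rewrite mem_pmap; apply/mapP; exists (pickle t).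
    by rewrite mem_iota add0n leq0n (@leq_bigmax_seq _ r predT (fun t => _)).
  by rewrite pickleK_inv.
rewrite (perm_big [seq t <- r' | t \in r]); last first.
  apply: uniq_perm; rewrite ?filter_uniq ?pmap_inv_uniq ?finmap.fset_uniq//.
  by move=> t; rewrite mem_filter; case: (boolP (t \in r)) => // /rr' ->.
rewrite big_filter [leRHS](bigID (fun t => t \in r))/= lerDl.
exact: sumr_ge0.
Qed.

Let cumul0 w : cumul w 0 = 0. Proof. exact: big_ord0. Qed.

(** The affine map sending the interval of [w] to [0, 1) turns that of [rcons w t] into the slot
    between two consecutive values of [cumul w]. *)
Let itv_rcons w t x : 0 < word_prob w -> itv (rcons w t) x =
  (cumul w (pickle t) <= (x - left_end w) / word_prob w < cumul w (pickle t).+1)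
  :> Prop.
Proof.
move=> w0; rewrite /itv/= in_itv/= left_end_rcons word_prob_rcons.
rewrite cumulS g_pickle ler_pdivlMr// ltr_pdivrMr//.
rewrite lerBrDl ltrBlDl [word_prob w * cumul _ _]mulrC -addrA.
by rewrite [word_prob w * q _ _]mulrC -mulrDl.
Qed.

Let itv_gt0 w x : itv w x -> 0 < word_prob w.
Proof.
rewrite /itv/= in_itv/= => /andP[lx xr]; rewrite lt0r word_prob_ge0 andbT.
by apply: contraTneq (le_lt_trans lx xr) => ->; rewrite addr0 ltxx.
Qed.

Let itv_rcons_gt0 w t x : itv (rcons w t) x -> 0 < word_prob w.
Proof.
move=> /itv_gt0; rewrite word_prob_rcons lt0r => /andP[+ _].
by rewrite mulf_eq0 negb_or lt0r word_prob_ge0 andbT => /andP[].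
Qed.

Let itv_sub w t : itv (rcons w t) `<=` itv w.
Proof.
move=> x xw; have w0 := itv_rcons_gt0 xw.
move: xw; rewrite itv_rcons// /itv/= in_itv/= => /andP[lx xr].
have := lt_le_trans xr (cumul_le1 _ (lt0r_neq0 w0)).
rewrite ltr_pdivrMr// mul1r ltrBlDl => ->; rewrite andbT.
have : 0 <= cumul w (pickle t) by rewrite -(cumul0 w) cumul_mono ?gt_eqF.
by move=> /le_trans/(_ lx); rewrite ler_pdivlMr// mul0r subr_ge0.
Qed.

Let itv_cover w x : itv w x -> exists t, itv (rcons w t) x.
Proof.
move=> xw; have w0 := itv_gt0 xw.
move: xw; rewrite {1}/itv/= in_itv/= => /andP[lx xr].
have y1 : (x - left_end w) / word_prob w < 1.
  by rewrite ltr_pdivrMr// mul1r ltrBlDl.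
(* The least index whose partial sum exceeds the rescaled point is some [n.+1]; the increment
   [g w n] is then positive, so [n] is the code of a state. *)
have [] := ex_minnP (cumul_gt (lt0r_neq0 w0) y1).
move=> [|n]; first by rewrite cumul0 ltNge divr_ge0 ?subr_ge0// ltW.
move=> yn n_min.
have ny : cumul w n <= (x - left_end w) / word_prob w.
  by rewrite leNgt; apply/negP => /n_min; rewrite ltnn.
have : 0 < g w n.
  by rewrite -(ltrD2l (cumul w n)) addr0 -cumulS (le_lt_trans ny).
case E : (@pickle_inv S n) => [t|]; last by rewrite /g E ltxx.
have nt : pickle t = n by have := @pickle_invK S n; rewrite E.
by move=> _; exists t; rewrite itv_rcons// nt ny.
Qed.

Let itv_inj w t t' x : itv (rcons w t) x -> itv (rcons w t') x -> t = t'.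
Proof.
move=> xt; have w0 := itv_rcons_gt0 xt.
move: xt; rewrite !itv_rcons// => /andP[lx xr] /andP[lx' xr'].
have w1 := lt0r_neq0 w0.
have [lt|lt|/(pcan_inj (@pickleK S))//] := ltngtP (pickle t) (pickle t').
  have := lt_le_trans xr (le_trans (cumul_mono w1 lt) lx').
  by rewrite ltxx.
have := lt_le_trans xr' (le_trans (cumul_mono w1 lt) lx).
by rewrite ltxx.
Qed.

Let itv_nil : itv [::] = `[0, 1[%classic.
Proof. by rewrite /itv /left_end /word_prob !big_ord0 add0r. Qed.

(** For [x] in [0, 1), [word x n] is the word of length [n] whose interval contains [x], and
    [traj x] reads these words off after a first state [s]. Outside [0, 1) the default of [xget]
    gives the constant sequence. *)
Let next x w : S := xget s [set t | itv (rcons w t) x].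

Let word x n : seq S := iter n (fun w => rcons w (next x w)) [::].

Let traj x : run_space s := fun n => last s (word x n).

Let mkseq_traj x n : mkseq (traj x) n.+1 = s :: word x n.
Proof.
elim: n => // n IH; rewrite mkseqS IH /traj /= last_rcons.
by rewrite -rcons_cons.
Qed.

Let wordP x n : itv [::] x -> itv (word x n) x.
Proof.
move=> x01; elim: n => //= n /itv_cover[t xt].
exact: (@xgetI _ s [set t | itv (rcons (word x n) t) x] t xt).
Qed.

Let itv_word x w : itv w x -> word x (size w) = w.
Proof.
elim/last_ind: w => [//|w t IH] xw; rewrite size_rcons /=.
rewrite IH; last exact: itv_sub xw.
congr rcons; apply: (itv_inj _ xw).
exact: (@xgetI _ s [set t | itv (rcons w t) x] t xw).
Qed.

Let word_out x n : ~ itv [::] x -> word x n = nseq n s.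
Proof.
move=> x01; have nx w : ~ itv w x.
  by elim/last_ind: w => // w t IH; contradict IH; exact: itv_sub IH.
elim: n => //= n ->; rewrite /next xgetPN; last by move=> t; exact: nx.
by rewrite -cats1 (cat_nseq n s [:: s]) -[[:: s]]/(nseq 1 s) -/(ncons n s _)
  -cat_nseq -nseqD addn1.
Qed.

(** The second term collects the points outside [0, 1); it vanishes once Lebesgue measure is
    restricted to [0, 1). *)
Let traj_cylinder w : traj @^-1` cylinder (s :: w) =
  itv w `|` (~` itv [::] `&` [set _ | w = nseq (size w) s]).
Proof.
have E x : (traj @^-1` cylinder (s :: w)) x = (word x (size w) = w).
  rewrite /= /cylinder/= mkseq_traj.
  by apply/propext; split => [[]|->].
apply/seteqP; split => [x|x]; rewrite E.
  move=> xw; have [x01|x01] := pselect (itv [::] x); [left|right].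
    by rewrite -xw; exact: wordP.
  by split => //=; rewrite -[LHS]xw word_out.
move=> [/itv_word//|[x01 /= xw]].
by rewrite word_out.
Qed.

Let measurable_traj :
  @measurable_fun _ _ (measurableTypeR R) (run_space s) setT traj.
Proof.
apply: (@measurability _ _ _ (run_space s) _ _
  (range (@cylinder S) : set (set (trajectory s)))) => // _ [_ [u _ <-] <-].
rewrite setTI; case: u => [|s' w].
  rewrite (_ : _ @^-1` _ = setT)//.
  by apply/seteqP; split.
have [->|s's] := eqVneq s' s.
  have mi v : measurable (itv v) by exact: measurable_itv.
  rewrite traj_cylinder.
  apply: measurableU => //.
  apply: measurableI; first exact: measurableC.
  have [ws|ws] := pselect (w = nseq (size w) s).
    rewrite (_ : [set _ | _] = setT)//.
    by apply/seteqP; split.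
  rewrite (_ : [set _ | _] = set0)//.
  by apply/seteqP; split.
rewrite (_ : _ @^-1` _ = set0)//; apply/seteqP; split => // x.
by rewrite /= /cylinder/= mkseq_traj => -[ss']; rewrite ss' eqxx in s's.
Qed.

Let m01 : measurable (`[0, 1[%classic : set (measurableTypeR R)).
Proof. exact: measurable_itv. Qed.

(** The image under [traj] of Lebesgue measure on [0, 1) works: the points of [0, 1) whose
    trajectory follows [w] form an interval of length [word_prob w]. *)
Lemma kernel_measure : exists P : probability (run_space s) R,
  forall w, P (cylinder (s :: w)) = (word_prob w)%:E.
Proof.
pose mu := pushforward (mrestr (@lebesgue_measure R) m01) traj.
have muE w : mu (cylinder (s :: w)) = (word_prob w)%:E.
  rewrite /mu /pushforward traj_cylinder /mrestr setIUl -itv_nil.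
  rewrite setIAC setICl set0I setU0 setIidl.
    rewrite lebesgue_measure_itv/= lte_fin ltrDl lt0r word_prob_ge0 andbT.
    by case: eqP => [->//|_]/=; rewrite -EFinD addrAC subrr add0r.
  by elim/last_ind: w => // w t IH; apply: subset_trans IH; exact: itv_sub.
have mu1 : mu setT = 1%E.
  rewrite -(_ : (word_prob [::])%:E = 1%E); last by rewrite /word_prob big_ord0.
  rewrite -muE /mu /pushforward; congr (mrestr _ _ _).
  by apply/seteqP; split => // x _; exact: (mkseq_traj x 0).
pose mu' : {measure set (run_space s) -> \bar R} :=
  measure_function_pushforward__canonical__measure_function_Measure
    (mrestr (@lebesgue_measure R) m01) measurable_traj.
have [P PE] := measure_probability (mu1 : mu' setT = 1%E).
by exists P => w; rewrite PE; exact: muE.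
Qed.

End KernelMeasure.

Section RunMeasureExists.
Variables (R : realType) (S : countType) (M : mdp R S).

Lemma dist_on_setT (B : set S) (f : S -> R) : dist_on B f -> dist_on setT f.
Proof.
move=> [f0 fB f1]; split => [//|t /(_ I)//|]; rewrite -f1 [RHS]esum_mkcond.
by apply: eq_esum => t _; case: ifPn => //; rewrite notin_setE => /fB ->.
Qed.

Lemma run_measure_exists (s : S) (sigma : strategy M) :
  exists P : probability (run_space s) R, run_measure sigma P.
Proof.
apply: kernel_measure => w w0.
(* Words of nonzero probability are paths, since choices and transition probabilities vanish off the
   successors. *)
suff ps : path (step M) s w.
  have [cw|cw] := boolP (ctrl M (last s w)).
    have -> : step_prob sigma s w = sigma s w.
      by apply/funext => t; rewrite /step_prob cw.
    exact: dist_on_setT (choice_dist sigma ps cw).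
  have -> : step_prob sigma s w = trans M (last s w).
    by apply/funext => t; rewrite /step_prob (negPf cw).
  exact: dist_on_setT (trans_dist cw).
elim/last_ind: w w0 => // w t IH.
rewrite word_prob_rcons mulf_eq0 negb_or => /andP[/IH ps].
rewrite rcons_path ps/=; apply: contraNT => /negP nst.
rewrite /step_prob; case: ifPn => [cw|cw].
  by have [_ ->] := choice_dist sigma ps cw.
by have [_ ->] := trans_dist cw.
Qed.

End RunMeasureExists.

(** * Finitely branching safety games *)

Section Safety.
Variables (R : realType) (S : countType) (M : mdp R S) (s0 : S).
Variables (Mem : Type) (m0 : Mem) (upd : Mem -> S -> S -> Mem).
Variable safe : Mem * S -> seq S.
Hypothesis safe_uniq : forall x, uniq (safe x).
Hypothesis safe_step : forall x t, t \in safe x -> step M x.2 t.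

Let next_conf (x : Mem * S) (t : S) : Mem * S := (upd x.1 x.2 t, t).

Definition conf_after (w : seq S) : Mem * S := foldl next_conf (m0, s0) w.

(** The shift skips [rho 0]: configurations start from [s0] whatever the first state of [rho] is. *)
Definition conf_at (rho : nat -> S) (n : nat) : Mem * S :=
  conf_after (mkseq (fun i => rho i.+1) n).

Definition safe_runs : set (nat -> S) :=
  [set rho | rho 0%N = s0 /\ forall i, rho i.+1 \in safe (conf_at rho i)].

Lemma conf_atS rho n :
  conf_at rho n.+1 = next_conf (conf_at rho n) (rho n.+1).
Proof. by rewrite /conf_at /conf_after mkseqS foldl_rcons. Qed.

Lemma conf_after2 w : (conf_after w).2 = last s0 w.
Proof.
by elim/last_ind: w => // w t _; rewrite /conf_after foldl_rcons last_rcons.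
Qed.

(** Only the [n] moves after [w] are tested, so that an induction on [n] can lengthen [w] letter by
    letter. *)
Let safe_until (w : seq S) (n : nat) : set (run_space s0) :=
  [set rho | cylinder (s0 :: w) rho /\ forall i,
     (size w <= i < size w + n)%N -> rho i.+1 \in safe (conf_at rho i)].

Let cylinder_cons (w : seq S) (rho : nat -> S) : cylinder (s0 :: w) rho ->
  mkseq (fun i => rho i.+1) (size w) = w.
Proof.
rewrite /cylinder/= => rhow; apply: (@eq_from_nth _ s0).
  by rewrite size_mkseq.
move=> i; rewrite size_mkseq => iw; rewrite nth_mkseq//.
have /= <- := congr1 (fun u => nth s0 u i.+1) rhow.
by rewrite (nth_map 0) ?size_iota// nth_iota.
Qed.

Let cylinder_rcons w t rho : cylinder (s0 :: rcons w t) rho <->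
  cylinder (s0 :: w) rho /\ rho (size w).+1 = t.
Proof.
rewrite /cylinder/= size_rcons -rcons_cons mkseqS; split.
  by move=> /rcons_inj/pair_equal_spec.
by move=> [-> ->].
Qed.

Let conf_at_local rho rho' n : (forall i, (i <= n)%N -> rho i = rho' i) ->
  conf_at rho n = conf_at rho' n.
Proof.
move=> E; congr conf_after; apply/eq_in_map => i.
by rewrite mem_iota => /andP[_ ilt]; rewrite E.
Qed.

Let measurable_safe_until w n : measurable (safe_until w n).
Proof.
apply: (@measurable_local _ _ (size w + n).+1) => rho rho' E [rhow rhoS].
split.
  move: rhow; rewrite /cylinder/= => <-; apply/eq_in_map => i.
  rewrite mem_iota add0n => /andP[_ ilt]; rewrite E//.
  by rewrite (leq_trans ilt)// ltnS leq_addr.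
move=> i /andP[wi iwn]; rewrite -E// -(@conf_at_local rho).
  by apply: rhoS; rewrite wi.
by move=> j ji; rewrite E// ltnS (leq_trans ji)// ltnW.
Qed.

Let safe_untilS w n : safe_until w n.+1 =
  \bigcup_(t in [set` safe (conf_after w)]) safe_until (rcons w t) n.
Proof.
apply/seteqP; split => rho;
    [move=> [rhow rhoS]|move=> [t /= tS [/cylinder_rcons[rhow rhot]]]].
  have wconf : conf_at rho (size w) = conf_after w.
    by rewrite /conf_at cylinder_cons.
  exists (rho (size w).+1) => /=.
    by rewrite -wconf; apply: rhoS; rewrite leqnn addnS ltnS leq_addr.
  split; first exact/cylinder_rcons.
  move=> i; rewrite size_rcons addSnnS => /andP[wi iwn].
  by apply: rhoS; rewrite ltnW.
rewrite size_rcons => rhoS; split => // i; rewrite leq_eqVlt.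
move=> /andP[/predU1P[<- _|wi iwn]].
  by rewrite rhot /conf_at cylinder_cons.
by apply: rhoS; rewrite wi addSnnS.
Qed.

(** The best probability of making [n] safe moves in a row; at a random state the unsafe successors
    contribute 0. *)
Fixpoint horizon_value (n : nat) (x : Mem * S) : R :=
  if n is n'.+1 then
    if ctrl M x.2 then
      \big[Num.max/0]_(t <- safe x) horizon_value n' (next_conf x t)
    else \sum_(t <- safe x) trans M x.2 t * horizon_value n' (next_conf x t)
  else 1.

Lemma sum_dist_on_le1 (B : set S) (f : S -> R) (r : seq S) :
  dist_on B f -> uniq r -> \sum_(t <- r) f t <= 1.
Proof.
move=> /dist_on_setT[f0 _ f1] ur; rewrite -lee_fin -f1 -sumEFin.
apply: esum_ge; exists [set` r]; first by split => //; exact: finite_seq.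
by rewrite fsbig_seq.
Qed.

Let horizon_valueS n x : horizon_value n.+1 x = if ctrl M x.2
  then \big[Num.max/0]_(t <- safe x) horizon_value n (next_conf x t)
  else \sum_(t <- safe x) trans M x.2 t * horizon_value n (next_conf x t).
Proof. by []. Qed.

Let le_max_safe (f : S -> R) (r : seq S) t :
  t \in r -> f t <= \big[Num.max/0]_(u <- r) f u.
Proof. by move=> tr; exact: (le_bigmax_seq _ _ _ _ tr). Qed.

Let trans_ge0 s t : ~~ ctrl M s -> 0 <= trans M s t.
Proof. by move=> /(trans_dist (m := M))[]. Qed.

Let horizon_value_ge0 n x : 0 <= horizon_value n x.
Proof.
elim: n x => //= n IH x; case: ifPn => [_|/trans_ge0 t0].
  by elim/big_ind: _ => // a b a0 b0; rewrite le_max a0.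
by apply: sumr_ge0 => t _; rewrite mulr_ge0.
Qed.

Let horizon_value_decr n x : horizon_value n.+1 x <= horizon_value n x.
Proof.
elim: n x => [|n IH] x.
  rewrite /=; case: ifPn => [_|nc].
    by elim/big_ind: _ => // a b a0 b0; rewrite ge_max a0.
  under eq_bigr do rewrite mulr1.
  exact: sum_dist_on_le1 (trans_dist nc) (safe_uniq x).
rewrite (horizon_valueS n.+1) (horizon_valueS n).
case: ifPn => [_|/trans_ge0 t0].
  rewrite big_seq; apply: bigmax_le => [|t tx].
    by elim/big_ind: _ => // a b a0 b0; rewrite le_max a0.
  exact: le_trans (IH _)
    (le_max_safe (fun u => horizon_value n (next_conf x u)) tx).
by apply: ler_sum => t _; rewrite ler_wpM2l//; exact: IH.
Qed.

Let horizon_value_mono m n x :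
  (m <= n)%N -> horizon_value n x <= horizon_value m x.
Proof.
move=> /subnK <-; elim: (n - m)%N => // k.
exact: le_trans (horizon_value_decr _ _).
Qed.

(** Horizon values decrease with the horizon, so this infimum is their limit. *)
Definition safety_value (x : Mem * S) : R := inf (range (horizon_value^~ x)).

Let has_inf_horizon x : has_inf (range (horizon_value^~ x)).
Proof.
split; first by exists 1, 0.
by exists 0 => _ [n _ <-].
Qed.

Let safety_value_le n x : safety_value x <= horizon_value n x.
Proof. by apply: ge_inf; [exact: (has_inf_horizon x).2|exists n]. Qed.

Let safety_value_ge0 x : 0 <= safety_value x.
Proof.
by apply: lb_le_inf; [exact: (has_inf_horizon x).1|move=> _ [n _ <-]].
Qed.

(** Each safe successor has a horizon of its own; as there are finitely many, the largest serves
    them all. *)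
Let horizon_approx (d : R) x : 0 < d -> exists n, forall t, t \in safe x ->
  horizon_value n (next_conf x t) <= safety_value (next_conf x t) + d.
Proof.
move=> d0; elim: (safe x) => [|t r [n nr]]; first by exists 0.
have [_ [m _ <-] mt] := inf_adherent d0 (has_inf_horizon (next_conf x t)).
exists (maxn m n) => t'; rewrite inE => /predU1P[->|/nr].
  by apply: le_trans (ltW mt); rewrite horizon_value_mono ?leq_maxl.
by apply: le_trans; rewrite horizon_value_mono ?leq_maxr.
Qed.

(* Finite branching makes the infimum over the horizons commute with the
   maximum over the successors. *)
Let safety_value_ctrl x : ctrl M x.2 -> 0 < safety_value x ->
  exists2 t, t \in safe x & safety_value x <= safety_value (next_conf x t).
Proof.
move=> cx vx; apply: contrapT => no_succ.
pose m := \big[Num.max/0]_(t <- safe x) safety_value (next_conf x t).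
have mv : m < safety_value x.
  rewrite /m big_seq; apply: bigmax_lt => // t tx; rewrite ltNge; apply/negP.
  by move=> vt; apply: no_succ; exists t.
(* With half the gap between [m] and the value of [x] as error, a common horizon [n] brings
   [horizon_value n.+1 x] strictly below [safety_value x]. *)
have [|n nd] := @horizon_approx ((safety_value x - m) / 2) x.
  by rewrite divr_gt0// subr_gt0.
have : horizon_value n.+1 x <= m + (safety_value x - m) / 2.
  rewrite /= cx big_seq; apply: bigmax_le => [|t tx].
    rewrite addr_ge0//; last by rewrite divr_ge0// subr_ge0 ltW.
    by rewrite /m; elim/big_ind: _ => // a b a0 b0; rewrite le_max a0.
  apply: le_trans (nd t tx) _; rewrite lerD2r.
  exact: (le_max_safe (fun u => safety_value (next_conf x u))).
have := safety_value_le n.+1 x; lra.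
Qed.

(** The safe successors have total weight at most 1, so an error [d] at each of them costs at most
    [d] on average. *)
Let safety_value_rand x : ~~ ctrl M x.2 ->
  safety_value x <=
  \sum_(t <- safe x) trans M x.2 t * safety_value (next_conf x t).
Proof.
move=> cx; apply/ler_addgt0Pr => d d0.
have [n nd] := horizon_approx x d0.
apply: le_trans (safety_value_le n.+1 x) _; rewrite /= (negPf cx).
have t0 := fun t => trans_ge0 t cx.
apply: (@le_trans _ _ (\sum_(t <- safe x)
    (trans M x.2 t * safety_value (next_conf x t) + trans M x.2 t * d))).
  rewrite big_seq [leRHS]big_seq; apply: ler_sum => t tx.
  by rewrite -mulrDr ler_wpM2l// nd.
rewrite big_split/= lerD2l -mulr_suml -[leRHS]mul1r ler_wpM2r ?(ltW d0)//.
exact: sum_dist_on_le1 (trans_dist cx) (safe_uniq x).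
Qed.

Section Measure.
Variables (sigma : strategy M) (P : probability (run_space s0) R).
Hypothesis P_sigma : run_measure sigma P.

Let prob := word_prob s0 (step_prob sigma s0).

Let P_safe_untilS w n : P (safe_until w n.+1) =
  (\sum_(t <- safe (conf_after w)) P (safe_until (rcons w t) n))%E.
Proof.
rewrite safe_untilS measure_fin_bigcup//.
- by rewrite [RHS]fsbig_seq ?safe_uniq.
- exact: finite_seq.
- move=> t t' _ _ [rho [[/cylinder_rcons[_ <-] _] [/cylinder_rcons[_ <-] _]]].
  by [].
Qed.

Let P_safe_until0 w : P (safe_until w 0) = (prob w)%:E.
Proof.
rewrite -P_sigma; congr (P _); apply/seteqP; split => [rho []//|rho rhow].
by split => // i; rewrite addn0 ltnNge andbN.
Qed.

Let prob_rcons w t :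
  prob (rcons w t) = prob w * step_prob sigma s0 w t.
Proof. exact: word_prob_rcons. Qed.

Let prob_ge0 w : 0 <= prob w.
Proof. by rewrite -lee_fin -P_sigma. Qed.

Let choice_dist_sigma w : path (step M) s0 w -> ctrl M (last s0 w) ->
  dist_on [set t | step M (last s0 w) t] (sigma s0 w).
Proof. exact: choice_dist. Qed.

Let path_rcons_safe w t : path (step M) s0 w -> t \in safe (conf_after w) ->
  path (step M) s0 (rcons w t).
Proof.
by move=> pw /safe_step; rewrite conf_after2 rcons_path pw.
Qed.

Let conf_after_rcons w t : conf_after (rcons w t) = next_conf (conf_after w) t.
Proof. by rewrite /conf_after foldl_rcons. Qed.

(** Backward induction: a randomised choice is an average, of total weight at most 1, of values
    bounded by their maximum. *)
Let safe_until_le n w : path (step M) s0 w ->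
  (P (safe_until w n) <= (prob w * horizon_value n (conf_after w))%:E)%E.
Proof.
elim: n w => [|n IH] w pw; first by rewrite P_safe_until0 mulr1.
rewrite P_safe_untilS; apply: (@le_trans _ _
  (\sum_(t <- safe (conf_after w)) (prob w * (step_prob sigma s0 w t *
    horizon_value n (next_conf (conf_after w) t)))%:E)%E).
  rewrite big_seq [leRHS]big_seq; apply: lee_sum => t tw.
  by rewrite mulrA -prob_rcons -conf_after_rcons IH// path_rcons_safe.
rewrite sumEFin lee_fin -mulr_sumr ler_wpM2l// horizon_valueS conf_after2.
rewrite /step_prob; case: ifPn => [cw|_ //].
have sd := choice_dist_sigma pw cw; have [c0 _ _] := sd.
set m := leRHS; have m_ge0 : 0 <= m.
  by rewrite /m; elim/big_ind: _ => // a b a0 b0; rewrite le_max a0.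
apply: (@le_trans _ _ (\sum_(t <- safe (conf_after w)) sigma s0 w t * m)).
  rewrite big_seq [leRHS]big_seq; apply: ler_sum => t tw.
  rewrite ler_wpM2l//; set y := conf_after w in tw *.
  exact: (le_max_safe (fun u => horizon_value n (next_conf y u))).
rewrite -mulr_suml -[leRHS]mul1r ler_wpM2r//.
exact: sum_dist_on_le1 sd (safe_uniq _).
Qed.

Let safe_runsE :
  (safe_runs : set (run_space s0)) = \bigcap_n safe_until [::] n.
Proof.
apply/seteqP; split => [rho [rho0 rhoS] n _|rho rhoS].
  by split; [rewrite /cylinder/= /mkseq/= rho0|move=> i _].
split; first by have [] := rhoS 0 I => -[].
by move=> i; have [_] := rhoS i.+1 I; apply => /=; rewrite add0n.
Qed.

Lemma measurable_safe_runs : measurable (safe_runs : set (run_space s0)).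
Proof. by rewrite safe_runsE; exact: bigcapT_measurable. Qed.

Let safe_until_nil_cvg :
  P (safe_until [::] n) @[n --> \oo] --> P (safe_runs : set (run_space s0)).
Proof.
rewrite safe_runsE; apply: nonincreasing_cvg_mu => //.
- by rewrite (le_lt_trans (probability_le1 _ _)) ?ltry.
- exact: bigcapT_measurable.
- move=> m n mn; apply/subsetPset => rho [rho0 rhoS]; split => // i /= im.
  by apply: rhoS; rewrite /= (leq_trans im).
Qed.

Let prob_nil : prob [::] = 1. Proof. exact: big_ord0. Qed.

Lemma safe_runs_le_value :
  (P (safe_runs : set (run_space s0)) <= (safety_value (m0, s0))%:E)%E.
Proof.
have fS := fin_num_measure P _ measurable_safe_runs.
rewrite -(fineK fS) lee_fin; apply: lb_le_inf.
  exact: (has_inf_horizon (m0, s0)).1.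
move=> _ [n _ <-]; rewrite -lee_fin fineK//.
rewrite -[horizon_value _ _]mul1r -prob_nil.
apply: le_trans (@safe_until_le n [::] isT).
rewrite le_measure ?inE//; first exact: measurable_safe_runs.
by rewrite safe_runsE => rho; exact.
Qed.

(** If the safety value never drops on average under [sigma], it bounds the probability of safety
    from below at every finite horizon, and continuity from above passes to the limit. *)
Lemma value_le_safe_runs :
  (forall w, path (step M) s0 w -> safety_value (conf_after w) <=
     \sum_(t <- safe (conf_after w))
       step_prob sigma s0 w t * safety_value (next_conf (conf_after w) t)) ->
  ((safety_value (m0, s0))%:E <= P (safe_runs : set (run_space s0)))%E.
Proof.
move=> bellman; have ge n w : path (step M) s0 w ->
    ((prob w * safety_value (conf_after w))%:E <= P (safe_until w n))%E.
  elim: n w => [|n IH] w pw.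
    by rewrite P_safe_until0 lee_fin ler_piMr ?(safety_value_le 0).
  rewrite P_safe_untilS.
  apply: (@le_trans _ _ (\sum_(t <- safe (conf_after w))
    (prob w * (step_prob sigma s0 w t *
      safety_value (next_conf (conf_after w) t)))%:E)%E).
    by rewrite sumEFin lee_fin -mulr_sumr ler_wpM2l// bellman.
  rewrite big_seq [leRHS]big_seq; apply: lee_sum => t tw.
  by rewrite mulrA -prob_rcons -conf_after_rcons IH// path_rcons_safe.
rewrite -(cvg_lim _ safe_until_nil_cvg)//; apply: lime_ge.
  by apply/cvg_ex; exists (P (safe_runs : set (run_space s0))).
by apply: nearW => n; rewrite -[safety_value _]mul1r -prob_nil; exact: ge.
Qed.

End Measure.

(** A move that keeps the safety value from dropping; by [safety_value_ctrl] it exists at controlled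
    states of positive value. The default is an arbitrary successor. *)
Let greedy (m : Mem) (s : S) : S :=
  xget (xchoose (step_total M s)) [set t | t \in safe (m, s) /\
    safety_value (m, s) <= safety_value (next_conf (m, s) t)].

Let greedy_step m s : ctrl M s -> step M s (greedy m s).
Proof.
move=> _; rewrite /greedy; case: xgetP => [t _ [/safe_step]//|_].
exact: xchooseP.
Qed.

Lemma safety_optimal : exists tau : det_mem_strategy M Mem,
  [/\ init_mode tau = m0, next_mode tau = upd &
    forall P' : probability (run_space s0) R,
    run_measure (mem_strategy tau) P' ->
    forall (sigma : strategy M) (P : probability (run_space s0) R),
    run_measure sigma P ->
    (P (safe_runs : set (run_space s0)) <=
     P' (safe_runs : set (run_space s0)))%E].
Proof.
pose tau := DetMemStrategy m0 upd greedy_step; exists tau.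
split => // P' P'_tau sigma P P_sigma.
apply: le_trans (safe_runs_le_value P_sigma) _.
apply: (value_le_safe_runs P'_tau) => w pw.
set x := conf_after w.
have xE : x = (mode_after tau m0 s0 w, last s0 w).
  rewrite /x /conf_after; elim: w m0 {pw x} s0 => //= t w IH m s.
  by rewrite IH.
have x2 : x.2 = last s0 w by rewrite xE.
have [cw|cw] := boolP (ctrl M (last s0 w)); last first.
  rewrite /step_prob (negPf cw) -x2; apply: safety_value_rand.
  by rewrite x2.
have := safety_value_ge0 x; rewrite le_eqVlt => /predU1P[<-|vx].
  by apply: sumr_ge0 => t _; rewrite /step_prob cw mulr_ge0.
have [t [tx vt]] := safety_value_ctrl (etrans (congr1 (ctrl M) x2) cw) vx.
have [gx vg] : greedy x.1 x.2 \in safe x /\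
    safety_value x <= safety_value (next_conf x (greedy x.1 x.2)).
  rewrite /greedy -surjective_pairing; case: xgetP => // /(_ t) /=; tauto.
apply: le_trans vg _; rewrite (bigD1_seq (greedy x.1 x.2))//=.
have -> : step_prob (mem_strategy tau) s0 w (greedy x.1 x.2) = 1.
  by rewrite /step_prob cw xE /= /mem_choice eqxx.
rewrite mul1r lerDl; apply: sumr_ge0 => u _; rewrite mulr_ge0//.
by rewrite /step_prob cw ler0n.
Qed.

End Safety.

(** * Rings visited by a transient winning run *)

Section Measurability.
Variables (S : countType) (s : S).

Lemma measurable_infinitely_often (Q : nat -> set (run_space s)) :
  (forall i, measurable (Q i)) ->
  measurable ([set rho | infinitely_often (Q^~ rho)] : set (run_space s)).
Proof.
move=> mQ; rewrite (_ : [set _ | _] =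
    \bigcap_n \bigcup_(m in [set m | (n <= m)%N]) Q m).
  by apply: bigcapT_measurable => n; exact: bigcup_measurable.
apply/seteqP; split => rho H n => [_|]; first by have [m] := H n; exists m.
by have [m] := H n I; exists m.
Qed.

Lemma measurable_GF (R : realType) (M : mdp R S) (A : set (S * S)) :
  measurable (GF M A : set (run_space s)).
Proof.
have mQ i (B : S -> S -> Prop) :
    measurable ([set rho | B (rho i) (rho i.+1)] : set (run_space s)).
  apply: (@measurable_local _ _ i.+2) => rho rho' E /=.
  by rewrite !E.
rewrite (_ : GF M A =
    \bigcap_i [set rho : nat -> S | step M (rho i) (rho i.+1)] `&`
    [set rho : nat -> S | infinitely_often (fun i => A (rho i, rho i.+1))]).
  apply: measurableI.
    by apply: bigcapT_measurable => i; exact: (mQ i (step M)).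
  apply: (@measurable_infinitely_often
    (fun i => [set rho : nat -> S | A (rho i, rho i.+1)])) => i.
  exact: (mQ i (fun u v => A (u, v))).
by apply/seteqP; split => rho [rs rA]; split=> // i; [move=> _|]; exact: rs.
Qed.

End Measurability.

(** Continuity from above: the sets [B] minus [E n] decrease to the empty set. *)
Lemma nondecreasing_exhaust d (T : measurableType d) (R : realType)
    (P : probability T R) (B : set T) (E : nat -> set T) (eps : R) :
  measurable B -> (forall n, measurable (E n)) ->
  (forall m n, (m <= n)%N -> E m `<=` E n) -> B `<=` \bigcup_n E n ->
  0 < eps -> exists n, (P (B `\` E n) <= eps%:E)%E.
Proof.
move=> mB mE homoE BE eps0.
have : P (B `\` E n) @[n --> \oo] --> P (\bigcap_n (B `\` E n)).
  apply: nonincreasing_cvg_mu.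
  - by rewrite (le_lt_trans (probability_le1 _ _)) ?ltry//; exact: measurableD.
  - by move=> n; exact: measurableD.
  - by apply: bigcapT_measurable => n; exact: measurableD.
  - move=> m n mn; apply/subsetPset; apply: setDS; exact: homoE.
have -> : \bigcap_n (B `\` E n) = set0.
  apply/seteqP; split => // x BEx; have [Bx _] := BEx 0 I.
  by have [n _ Enx] := BE x Bx; have [] := BEx n I.
rewrite measure0 => P0; apply: contrapT => /forallNP noE.
suff: (eps%:E <= 0)%E by rewrite lee_fin leNgt eps0.
apply: (cvge_ge _ P0); apply: nearW => n.
by rewrite leNgt; apply/negP => /ltW; exact: noE.
Qed.

Section Rings.
Variables (R : realType) (S : countType) (M : mdp R S) (s0 : S).
Variable A : nat -> set (S * S).
Variables (C : countType) (clock : nat -> C).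

(** The clock serves both claims at once: with a constant clock this is transience of the states,
    with a step counter it holds for every sequence. *)
Definition transient_runs : set (nat -> S) :=
  [set rho | forall x, ~ infinitely_often (fun i => (clock i, rho i) = x)].

Lemma measurable_transient_runs :
  measurable (transient_runs : set (run_space s0)).
Proof.
rewrite -[transient_runs]setCK; apply: measurableC.
rewrite (_ : ~` _ = \bigcup_x [set rho : nat -> S |
    infinitely_often (fun i => (clock i, rho i) = x)]).
  apply: countable_bigcupT_measurable => [|x]; first exact: countableP.
  apply: (@measurable_infinitely_often _ _
    (fun i => [set rho : nat -> S | (clock i, rho i) = x])) => i.
  by apply: (@measurable_local _ _ i.+1) => rho rho' E /=; rewrite E.
apply/seteqP; split => rho; first by move=> /existsNP[x /contrapT]; exists x.
by move=> [x _ rx] /(_ x).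
Qed.

(** Only finitely many pairs have a code below [f], and each is left for good; the induction adds
    one code at a time. *)
Lemma transient_runs_escape rho f : transient_runs rho ->
  exists n, forall i, (n <= i)%N -> (f <= pickle (clock i, rho i))%N.
Proof.
move=> rho_tr; elim: f => [|f [n IH]]; first by exists 0.
have [[x xf]|nof] := pselect (exists x : C * S, pickle x = f).
  have /existsNP[m mP] := rho_tr x; exists (maxn m n) => i.
  rewrite geq_max => /andP[mi /IH]; rewrite leq_eqVlt => /predU1P[fi|//].
  by case: mP; exists i => //; apply: (pcan_inj pickleK); rewrite -fi.
exists n => i /IH; rewrite leq_eqVlt => /predU1P[fi|//].
by case: nof; exists (clock i, rho i).
Qed.

(** The finite sets of the exhaustion are encoded by bounds on [pickle]. The last condition also
    places the transition at time [m] below the outer bound. *)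
Definition ring_runs (j f N f' : nat) : set (nat -> S) :=
  [set rho | [/\ forall i, (N < i)%N -> (f <= pickle (clock i, rho i))%N,
    exists2 m, (m < N)%N &
      (f <= pickle (clock m, rho m))%N /\ A j (rho m, rho m.+1) &
    forall i, (i <= N)%N -> (pickle (clock i, rho i) < f')%N]].


(** The conditions without the outer bound are separated because [N] has to be chosen before that
    bound. *)
Let escape_runs j f N : set (run_space s0) := [set rho |
  (forall i, (N < i)%N -> (f <= pickle (clock i, rho i))%N) /\
  exists2 m, (m < N)%N &
    (f <= pickle (clock m, rho m))%N /\ A j (rho m, rho m.+1)].

Let confined_runs N f : set (run_space s0) :=
  [set rho | forall i, (i <= N)%N -> (pickle (clock i, rho i) < f)%N].

Let ring_runsE j f N f' : ring_runs j f N f' =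
  escape_runs j f N `&` confined_runs N f' :> set (nat -> S).
Proof. by apply/seteqP; split => [rho []//|rho [[]]]. Qed.

Let measurable_escape_runs j f N : measurable (escape_runs j f N).
Proof.
apply: measurableI.
  apply: (@bigcap_measurableType _ _ (fun i =>
    [set rho : run_space s0 | (f <= pickle (clock i, rho i))%N])
    [set i | (N < i)%N]) => i _.
  by apply: (@measurable_local _ _ i.+1) => rho rho' H /=; rewrite H.
apply: (@measurable_local _ _ N.+1) => rho rho' H /= [m mN fm].
by exists m => //; rewrite -(H m (leqW mN)) -(H m.+1 mN).
Qed.

Let measurable_confined_runs N f : measurable (confined_runs N f).
Proof.
apply: (@measurable_local _ _ N.+1) => rho rho' H /= fi i iN.
by rewrite -H//; exact: fi.
Qed.

Lemma measurable_ring_runs j f N f' :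
  measurable (ring_runs j f N f' : set (run_space s0)).
Proof. by rewrite ring_runsE; exact: measurableI. Qed.

Let phi : set (run_space s0) := \bigcap_i GF M (A i) `&` transient_runs.

Let measurable_phi : measurable phi.
Proof.
apply: measurableI; last exact: measurable_transient_runs.
by apply: bigcapT_measurable => i; exact: measurable_GF.
Qed.

Lemma ring_choice (P : probability (run_space s0) R) j f d : 0 < d ->
  exists N f', (f < f')%N /\ (P (phi `\` ring_runs j f N f') <= d%:E)%E.
Proof.
move=> d0; have d2 : 0 < d / 2 by rewrite divr_gt0.
have [||N PN] := nondecreasing_exhaust P measurable_phi
    (measurable_escape_runs j f) _ _ d2.
- move=> m n mn rho [rho1 [i im ri]]; split.
    by move=> k nk; apply: rho1; exact: leq_ltn_trans nk.
  by exists i => //; exact: leq_trans mn.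
- move=> rho [rphi /(transient_runs_escape f)[n nP]].
  (* The transition of [A j] is sought after the escape time [n], so its source already lies outside
     the inner set. *)
  have [_ /(_ n)[m nm Am]] := rphi j I.
  exists m.+1 => //; split=> [i mi|].
    by apply: nP; rewrite (leq_trans nm)// ltnW// ltnW.
  by exists m => //; split => //; exact: nP.
(* Finitely many pairs are visited up to time [N]; the form [f + f'.+1] makes the outer bound exceed
   [f]. *)
have [||f' Pf'] := nondecreasing_exhaust P measurable_phi
    (fun f' => measurable_confined_runs N (f + f'.+1)) _ _ d2.
- move=> m n mn rho H i /H /leq_trans; apply.
  by rewrite leq_add2l ltnS.
- move=> rho _; exists (\max_(i < N.+1) pickle (clock i, rho i))%N => //.
  move=> i iN; rewrite addnS ltnS.
  apply: leq_trans (leq_addl _ _).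
  have iN' : (i < N.+1)%N by [].
  exact: (leq_bigmax (Ordinal iN')).
exists N, (f + f'.+1)%N; split; first by rewrite addnS ltnS leq_addr.
rewrite ring_runsE.
rewrite setDIr (le_trans (measureU2 _ _ _))//; try exact: measurableD.
by rewrite [d]splitr EFinD leeD.
Qed.

(** The rings are chosen one after the other; ring [j] loses at most eps / 2^(j+1), which sums to
    [eps]. *)
Lemma ring_sequence (P : probability (run_space s0) R) (eps : R) : 0 < eps ->
  exists f N : nat -> nat, [/\ f 0%N = 0%N, forall j, (f j < f j.+1)%N &
    (P phi <= P (phi `&` \bigcap_j ring_runs j (f j) (N j) (f j.+1)
                   : set (run_space s0)) + eps%:E)%E].
Proof.
move=> eps0.
have /choice[g gP] (jf : nat * nat) : exists Nf : nat * nat, (jf.2 < Nf.2)%N /\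
    (P (phi `\` ring_runs jf.1 jf.2 Nf.1 Nf.2) <=
     (eps / (2 ^ jf.1.+1)%:R)%:E)%E.
  have [|N [f' Nf']] := @ring_choice P jf.1 jf.2 (eps / (2 ^ jf.1.+1)%:R).
    by rewrite divr_gt0// ltr0n expn_gt0.
  by exists (N, f').
pose f := fix f j := if j is j'.+1 then (g (j', f j')).2 else 0%N.
pose N j := (g (j, f j)).1.
exists f, N; split => // [j|]; first by have [] := gP (j, f j).
set G := fun j => ring_runs j (f j) (N j) (f j.+1) : set (run_space s0).
have mG : measurable (\bigcap_j G j).
  by apply: bigcapT_measurable => j; exact: measurable_ring_runs.
have mphiG j : measurable (phi `\` G j).
  by apply: measurableD => //; exact: measurable_ring_runs.
have PG : (P (phi `\` \bigcap_j G j) <= eps%:E)%E.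
  apply: le_trans (epsilon_trick0 xpredT (ltW eps0)).
  apply: le_trans (measure_sigma_subadditive P mphiG _ _) _.
  - exact: measurableD.
  - by rewrite setDE setC_bigcap setI_bigcupr.
  - by apply: lee_nneseries => // j _; have [] := gP (j, f j).
apply: le_trans (leeD2l _ PG).
rewrite -{1}(setUIDK phi (\bigcap_j G j)).
by apply: measureU2; [exact: measurableI|exact: measurableD].
Qed.

End Rings.

(** * Phases *)

Section Phases.
Variables (R : realType) (S : countType) (M : mdp R S) (s0 : S).
Variable A : nat -> set (S * S).
Hypothesis A_decr : forall i j, (i <= j)%N -> A j `<=` A i.
Variables (C : countType) (c0 : C) (tick : C -> C).
Variable f : nat -> nat.
Hypothesis f_incr : forall j, (f j < f j.+1)%N.

Let clock i := iter i tick c0.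

Let ex_level (x : C * S) : exists j, (pickle x < f j)%N.
Proof.
exists (pickle x).+1; elim: (pickle x).+1 => // n IH.
exact: leq_ltn_trans IH (f_incr _).
Qed.

(** The first set of the exhaustion containing [x]: level [j.+1] is the ring of codes from [f j] up
    to, but excluding, [f j.+1]. *)
Definition level (x : C * S) : nat := ex_minn (ex_level x).

Lemma level_le x j : (level x <= j)%N = (pickle x < f j)%N.
Proof.
rewrite /level; case: ex_minnP => n nx n_min.
apply/idP/idP => [nj|/n_min//].
apply: leq_trans nx _; rewrite -(subnK nj); elim: (j - n)%N => // k IH.
exact: leq_trans IH (ltnW (f_incr _)).
Qed.

(* Within levels [2k-1] and [2k], the bit tells whether phase [k] is still
   going on or phase [k+1] has started. *)
Definition phase (y : (C * bool) * S) : nat :=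
  let q := uphalf (level (y.1.1, y.2)) in
  if odd q == y.1.2 then q else q.+1.

Definition phase_end (y : (C * bool) * S) (t : S) : bool :=
  (level (y.1.1, y.2) == (phase y).*2) && `[< A (phase y) (y.2, t) >].

Definition update (m : C * bool) (s t : S) : C * bool :=
  (tick m.1, m.2 (+) phase_end (m, s) t).

(** A move is safe if the phase read off the new state and bit is the old one, plus one when the
    move ends the phase. Enumerating codes below a bound makes the list finite. *)
Definition safe_succ (y : (C * bool) * S) : seq S :=
  [seq t <- undup (map snd (pmap (@unpickle (C * S)%type)
                                 (iota 0 (f (phase y).+1.*2)))) |
     step M y.2 t &&
     (phase (update y.1 y.2 t, t) == phase y + phase_end y t)%N].

Lemma safe_succ_uniq y : uniq (safe_succ y).
Proof. by rewrite filter_uniq// undup_uniq. Qed.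

Lemma odd_phase y : odd (phase y) = y.1.2.
Proof. by rewrite /phase; case: eqP => //=; case: odd y.1.2 => -[]. Qed.

Lemma phase_eq y k : y.1.2 = odd k ->
  (k.-1 <= uphalf (level (y.1.1, y.2)) <= k)%N -> (0 < k)%N -> phase y = k.
Proof.
rewrite /phase; set q := uphalf _ => -> /andP[kq qk] k0.
have [->|qnk] := eqVneq q k; first by rewrite eqxx.
have -> : k = q.+1 by apply/eqP; lia.
by rewrite /=; case: odd.
Qed.

Lemma uphalf_level_le y : (uphalf (level (y.1.1, y.2)) <= phase y)%N.
Proof. by rewrite /phase; case: ifP. Qed.

(** The code bound excludes no such move: a level is at most twice the phase, and the new phase is
    at most [(phase y).+1]. *)
Lemma mem_safe_succ y t : (t \in safe_succ y) =
  step M y.2 t && (phase (update y.1 y.2 t, t) == phase y + phase_end y t)%N.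
Proof.
rewrite mem_filter andb_idr// => /andP[_ /eqP ph].
rewrite mem_undup; apply/mapP; exists (tick y.1.1, t) => //.
rewrite mem_pmap; apply/mapP; exists (pickle (tick y.1.1, t)).
  rewrite mem_iota add0n leq0n -level_le.
  have := uphalf_level_le (update y.1 y.2 t, t); rewrite ph /=.
  by case: phase_end => /=; lia.
by rewrite pickleK.
Qed.

Lemma safe_succ_step y t : t \in safe_succ y -> step M y.2 t.
Proof. by rewrite mem_safe_succ => /andP[]. Qed.

(** The initial bit is [true] because phase 1 is odd. *)
Let conf := conf_at s0 (c0, true) update.

Let conf_clock rho i : (conf rho i).1.1 = clock i.
Proof. by elim: i => // i IH; rewrite /conf conf_atS /= IH. Qed.


Let conf_state rho i : rho 0%N = s0 -> (conf rho i).2 = rho i.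
Proof. by case: i => [->//|i] _; rewrite /conf conf_atS. Qed.

Let K rho i := phase (conf rho i).

Let update_conf rho i :
  update (conf rho i).1 (conf rho i).2 (rho i.+1) = (conf rho i.+1).1.
Proof. by rewrite [in RHS]/conf conf_atS. Qed.

Lemma rings_safe rho N : f 0%N = 0%N -> rho 0%N = s0 ->
  (forall i, step M (rho i) (rho i.+1)) ->
  (forall j, ring_runs A clock j (f j) (N j) (f j.+1) rho) ->
  safe_runs s0 (c0, true) update safe_succ rho.
Proof.
move=> f0 rho0 rho_step rings; split => //.
pose lev i := level (clock i, rho i).
have lev_conf i : level ((conf rho i).1.1, (conf rho i).2) = lev i.
  by rewrite conf_clock conf_state.
have lev_gt j i : (N j < i)%N -> (j < lev i)%N.
  by have [lo _ _] := rings j; move=> /lo; rewrite ltnNge level_le -leqNgt.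
have lev_le j i : (i <= N j)%N -> (lev i <= j.+1)%N.
  by have [_ _ hi] := rings j; move=> /hi; rewrite level_le.
have /choice[T TP] j : exists m, (m < N j)%N /\
    lev m = j.+1 /\ A j (rho m, rho m.+1).
  have [_ [m mN [fm Am]] _] := rings j; exists m; split => //; split => //.
  apply/eqP; rewrite eqn_leq lev_le ?(ltnW mN)//=.
  by rewrite ltnNge level_le -leqNgt.
have lev_gt0 i : (0 < lev i)%N by rewrite ltnNge level_le f0.
(* In phase [k], the end of the phase still lies ahead, and the levels at most
   [2k-4] have been left for good. *)
pose inv i k := [/\ (0 < k)%N, (i <= T k.*2.-1)%N &
  (2 <= k)%N -> (N (k.*2 - 4)%N < i)%N].
have inv_phase i k : inv i k -> (conf rho i).1.2 = odd k -> K rho i = k.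
  move=> [k0 iT Ni] oddk; apply: phase_eq => //; rewrite lev_conf.
  (* Up to time N_{2k-1} levels are at most 2k, and after N_{2k-4} they are at least 2k-3, so their
     upper halves are k-1 or k. *)
  have hi : (lev i <= k.*2)%N.
    have [TN _] := TP k.*2.-1; have := lev_le _ _ (leq_trans iT (ltnW TN)).
    lia.
  have := lev_gt0 i.
  case: (leqP 2 k) => [k2|]; last by lia.
  have := lev_gt _ _ (Ni k2); lia.
have step_inv i k : inv i k -> K rho i = k ->
    inv i.+1 (k + phase_end (conf rho i) (rho i.+1))%N.
  move=> [k0 iT Ni] Kk; rewrite /phase_end lev_conf -/(K rho i) Kk.
  rewrite conf_state//.
  have [TN [levT AT]] := TP k.*2.-1.
  case: asboolP => [Ai|nAi]; rewrite ?andbT ?andbF; last first.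
    rewrite addn0; split => //; last by move=> /Ni /ltnW.
    (* At time T_{2k-1} the level is 2k and the transition lies in A_{2k-1}, a subset of A_k: the
       phase would end there. *)
    rewrite ltn_neqAle iT andbT; apply/eqP => iE.
    by apply: nAi; rewrite iE; apply: A_decr AT; lia.
  case: eqP => [levi|levi]; last first.
    rewrite addn0; split => //; last by move=> /Ni /ltnW.
    rewrite ltn_neqAle iT andbT; apply/eqP => iE.
    by apply: levi; rewrite iE levT; lia.
  have [TN' [levT' _]] := TP (k + true).*2.-1.
  split; first by lia.
    (* The next deadline T_{2k+1} is at level 2k+2, whereas up to N_{2k-1} levels are at most 2k. *)
    rewrite ltnNge; apply/negP => T'i.
    have := lev_le _ _ (leq_trans T'i (leq_trans iT (ltnW TN))).
    by rewrite levT'; lia.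
  (* Level 2k is not reached before N_{2k-2}. *)
  move=> _; rewrite ltnS leqNgt; apply/negP => iN.
  by have := lev_le _ _ (ltnW iN); rewrite levi; lia.
have step_conf i k : inv i k -> K rho i = k ->
    K rho i.+1 = (k + phase_end (conf rho i) (rho i.+1))%N.
  move=> ik Kk; apply: inv_phase; first exact: step_inv.
  rewrite -update_conf /= -surjective_pairing oddD oddb.
  by rewrite -Kk /K odd_phase.
have invK i : inv i (K rho i).
  elim: i => [|i IH]; last by rewrite (step_conf _ _ IH erefl); exact: step_inv.
  have inv01 : inv 0 1 by [].
  by rewrite (inv_phase 0 1).
move=> i; rewrite mem_safe_succ conf_state// rho_step/=.
have := update_conf rho i; rewrite conf_state// => ->.
rewrite -(step_conf _ _ (invK i) erefl) /K.
by rewrite -[X in (_, X)](conf_state i.+1 rho0) -surjective_pairing.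
Qed.

(** The phase never decreases. If it were bounded, the run would stay in a finite set, against
    transience; so every phase ends, by a transition of the corresponding [A] set. *)
Lemma safe_transient_GF rho :
  safe_runs s0 (c0, true) update safe_succ rho -> transient_runs clock rho ->
  (\bigcap_i GF M (A i)) rho.
Proof.
move=> [rho0 rho_safe] rho_tr.
have rho_step i : step M (rho i) (rho i.+1).
  by have := safe_succ_step (rho_safe i); rewrite conf_state.
have KS i : K rho i.+1 = (K rho i + phase_end (conf rho i) (rho i.+1))%N.
  have := rho_safe i; rewrite mem_safe_succ => /andP[_ /eqP <-].
  by rewrite /K [in LHS]/conf conf_atS.
have K_mono : {homo K rho : i j / (i <= j)%N}.
  by apply: homo_leq => [//|k i j|i]; [exact: leq_trans|rewrite KS leq_addr].
have K_unbounded B : exists i, (B <= K rho i)%N.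
  apply: contrapT => /forallNP KB.
  have [n nP] := transient_runs_escape (f B.*2) rho_tr.
  have := nP n (leqnn n); rewrite leqNgt -level_le => /negP; apply.
  have := uphalf_level_le (conf rho n); rewrite conf_clock conf_state//.
  by move: (KB n) => /negP; rewrite -/(K rho n); lia.
move=> j _; split => // n.
(* The step that first brings the phase to [B] comes after time [n] and ends phase [B.-1], which is
   at least [j], so its transition lies in [A j]. *)
pose B := (maxn j (K rho n)).+1.
have [i Bi i_min] := ex_minnP (K_unbounded B).
have ni : (n < i)%N.
  by rewrite ltnNge; apply/negP => /K_mono; rewrite /B in Bi; lia.
case: i ni Bi i_min => // m nm Bm m_min; exists m => //.
have Km : (K rho m < B)%N by rewrite ltnNge; apply/negP => /m_min; rewrite ltnn.
move: Bm; rewrite KS /phase_end -/(K rho m) conf_state//.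
case: asboolP => [Am Bm|_]; last by rewrite andbF; lia.
by apply: A_decr Am; move: Bm; rewrite /B; case: (_ == _) => /=; lia.
Qed.

End Phases.

(** * Nearly optimal strategies *)

Lemma measure_le_negligible d (T : measurableType d) (R : realType)
    (P : probability T R) (B C N : set T) :
  measurable B -> measurable C -> measurable N -> P N = 0%E ->
  B `<=` C `|` N -> (P B <= P C)%E.
Proof.
move=> mB mC mN N0 BCN; rewrite -[leRHS]adde0 -N0.
apply: le_trans (measureU2 _ mC mN).
by rewrite le_measure ?inE//; exact: measurableU.
Qed.

(** One half of [eps] pays for the choice of [sigma], the other for the rings. Then P phi - eps/2 <=
    P safety <= P' safety <= P' phi, by [rings_safe], optimality for safety and
    [safe_transient_GF]. *)
Lemma eps_optimal_clock_bit (R : realType) (S : countType) (M : mdp R S)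
    (s0 : S) (A : nat -> set (S * S)) (C : countType) (c0 : C) (tick : C -> C)
    (eps : R) :
  (forall i j, (i <= j)%N -> A j `<=` A i) -> 0 < eps ->
  (forall (sigma : strategy M) (P : probability (run_space s0) R),
    run_measure sigma P ->
    {ae P, forall rho, transient_runs (fun i => iter i tick c0) rho}) ->
  exists tau : det_mem_strategy M (C * bool),
    [/\ (init_mode tau).1 = c0,
        forall m s t, (next_mode tau m s t).1 = tick m.1 &
        eps_optimal (\bigcap_i GF M (A i)) s0 eps (mem_strategy tau)].
Proof.
move=> A_decr eps0 transient.
pose phi : set (run_space s0) := \bigcap_i GF M (A i).
have mphi : measurable phi.
  by apply: bigcapT_measurable => i; exact: measurable_GF.
pose T : set (run_space s0) := transient_runs (fun i => iter i tick c0).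
have mT : measurable T by exact: measurable_transient_runs.
have nT (sigma : strategy M) (P : probability (run_space s0) R) :
    run_measure sigma P -> P (~` T) = 0%E.
  move=> P_sigma; apply/negligibleP; first exact: measurableC.
  exact: transient P_sigma.
have [sigma [P [P_sigma val_le]]] : exists (sigma : strategy M)
    (P : probability (run_space s0) R), run_measure sigma P /\
    (value M phi s0 - (eps / 2)%:E <= P phi)%E.
  (* Some strategy is needed to know that the value is finite, a supremum over the empty set being
     minus infinity. *)
  have any_step (m : unit) s : ctrl M s -> step M s (xchoose (step_total M s)).
    by move=> _; exact: xchooseP.
  pose sigma0 := mem_strategy
    (DetMemStrategy tt (fun _ _ _ => tt) any_step).
  have [P0 P0_sigma] := run_measure_exists s0 sigma0.
  have val_fin : value M phi s0 \is a fin_num.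
    rewrite fin_numElt; apply/andP; split.
      apply: (@lt_le_trans _ _ 0%E); first exact: ltNyr.
      apply: (@le_trans _ _ (P0 phi)) => //.
      by apply: ereal_sup_ubound; exists sigma0, P0.
    apply: (@le_lt_trans _ _ 1%E); last exact: ltry.
    apply: ge_ereal_sup => _ [sigma [P _ ->]].
    exact: probability_le1.
  have [|_ [sigma [P P_sigma ->]] /ltW] :=
    ub_ereal_sup_adherent (_ : 0 < eps / 2) val_fin; last by exists sigma, P.
  by rewrite divr_gt0.
have [|f [N [f0 f_incr ringsP]]] :=
  @ring_sequence R S M s0 A C (fun i => iter i tick c0) P (eps / 2).
  by rewrite divr_gt0.
have [tau [tau0 tauS tau_opt]] := safety_optimal
  s0 (c0, true) (update A tick f_incr) (safe_succ_uniq M A tick f_incr)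
  (@safe_succ_step R S M A C tick f f_incr).
exists tau; split; [by rewrite tau0|by rewrite tauS|].
have [P' P'_tau] := run_measure_exists s0 (mem_strategy tau).
exists P' => //.
set safe := safe_succ M A tick f_incr.
pose safety : set (run_space s0) :=
  safe_runs s0 (c0, true) (update A tick f_incr) safe.
have msafety : measurable safety by exact: measurable_safe_runs.
have P'phi : (P' safety <= P' phi)%E.
  apply: (measure_le_negligible msafety mphi (measurableC mT) (nT _ _ P'_tau)).
  move=> rho rho_safe; have [rho_tr|] := pselect (T rho); [left|by right].
  exact: safe_transient_GF rho_safe rho_tr.
(* The run space also contains sequences with another first state; they are null. *)
have P_start : P (~` cylinder [:: s0]) = 0%E.
  rewrite probability_setC; last by apply: sub_sigma_algebra; exists [:: s0].
  by rewrite (P_sigma [::]) big_ord0 subee.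
pose G : set (run_space s0) := phi `&` T `&`
  \bigcap_j ring_runs A (fun i => iter i tick c0) j (f j) (N j) (f j.+1).
have mG : measurable G.
  apply: measurableI; first exact: measurableI.
  by apply: bigcapT_measurable => j; exact: measurable_ring_runs.
have PG : (P G <= P safety)%E.
  apply: (measure_le_negligible mG msafety _ P_start).
    by apply: measurableC; apply: sub_sigma_algebra; exists [:: s0].
  move=> rho [[rho_phi _] rho_rings].
  have [rho0|] := pselect (cylinder [:: s0] rho); [left|by right].
  apply: (rings_safe A_decr f_incr f0) => [|i|j].
  - by move: rho0; rewrite /cylinder /= => -[].
  - by have [] := rho_phi 0 I.
  - exact: rho_rings.
have P_phi : (P phi <= P safety + (eps / 2)%:E)%E.
  apply: (le_trans _ (leeD2r _ PG)); apply: le_trans ringsP.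
  apply: (measure_le_negligible mphi _ (measurableC mT) (nT _ _ P_sigma)).
    exact: measurableI.
  by move=> rho rho_phi; have [rho_tr|] := pselect (T rho); [left|right].
rewrite [eps]splitr EFinD.
have := le_trans (tau_opt _ P'_tau _ _ P_sigma) P'phi.
move=> /(leeD2r (eps / 2)%:E)/(le_trans P_phi)/(le_trans val_le).
rewrite leeBlDr// -addeA -leeBlDr//.
Qed.

Theorem corollary18 (R : realType) (S : countType) (M : mdp R S) (s0 : S)
    (A : nat -> set (S * S)) (eps : R)
    (A_step : forall i, A i `<=` [set e | step M e.1 e.2])
    (A_decr : forall i j, (i <= j)%N -> A j `<=` A i)
    (eps_gt0 : 0 < eps) :
  let phi := \bigcap_i GF M (A i) in
  (universally_transient M ->
    exists (Mem : finType) (tau : det_mem_strategy M Mem),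
      (#|Mem| <= 2)%N /\ eps_optimal phi s0 eps (mem_strategy tau)) /\
  (exists tau : det_mem_strategy M (nat * bool),
    counts_steps tau /\ eps_optimal phi s0 eps (mem_strategy tau)).
Proof.
split=> [transient|].
  (* A one-point clock leaves just the bit as memory. *)
  have [|tau [_ _ tau_opt]] := @eps_optimal_clock_bit R S M s0 A unit tt id eps
      A_decr eps_gt0.
    move=> sigma P P_sigma; apply: negligibleS (transient _ _ _ P_sigma).
    move=> rho; apply: contra_not => rho_tr [u q] io; apply: (rho_tr q) => n.
    by have [m nm [_ mq]] := io n; exists m.
  exists (unit * bool)%type, tau; split => //.
  by rewrite card_prod card_unit card_bool.
(* With the step counter as clock no pair of clock value and state recurs, hence transience is
   automatic. *)
have [|tau [tau0 tauS tau_opt]] := @eps_optimal_clock_bit R S M s0 A nat 0%N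
    succn eps A_decr eps_gt0.
  move=> sigma P P_sigma; apply: aeW => rho [k q] io.
  have [m km [mk _]] := io k.+1.
  have clockE i : iter i succn 0%N = i by elim: i => //= i ->.
  by move: km; rewrite -mk clockE ltnn.
by exists tau; split.
Qed.
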